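(* Let $n\geq 1$ be an integer and let $g\in \mathrm{Sp}(n,\mathbb{Q})$. Then there exist two matrices $\sigma,\sigma'\in \mathrm{Sp}(n,\mathbb{Z})$ and a diagonal matrix $\mathbf{d}=\mathrm{diag}(d_1,\ldots,d_n)$ whose diagonal entries are positive integers with $d_1\mid d_2\mid\cdots\mid d_n$, such that $$g=\sigma\begin{pmatrix}\mathbf{d}&\mathbf{0}\\ \mathbf{0}&\mathbf{d}^{-1}\end{pmatrix}\sigma'.$$
   Context: For a commutative ring $R$ with unity, $\mathrm{Sp}(n,R)=\{g\in \mathrm{GL}(2n,R)\mid {}^t g J g=J\}$, where $J=\begin{pmatrix}\mathbf{0}&\mathbf{1}_n\\ -\mathbf{1}_n&\mathbf{0}\end{pmatrix}$ is written in blocks of size $n$ and $\mathbf{1}_n$ is the $n\times n$ identity matrix. *)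

(* Defs.v *)
From mathcomp Require Import all_boot all_order all_algebra.
Set Implicit Arguments.
Unset Strict Implicit.
Unset Printing Implicit Defensive.
Import GRing.Theory.
Local Open Scope ring_scope.

Definition sympJ (n : nat) (R : comUnitRingType) : 'M[R]_(n + n) :=
  block_mx 0 1%:M (- 1%:M) 0.
Arguments sympJ : clear implicits.

(* The size 2n is written n + n, the form that block_mx produces. *)
Definition Sp (n : nat) (R : comUnitRingType) : {pred 'M[R]_(n + n)} :=
  [pred g | (g \in unitmx) && (g^T *m sympJ n R *m g == sympJ n R)].
Arguments Sp : clear implicits.

(* Main.v *)
Require Import Defs.
From mathcomp Require Import all_boot all_order all_algebra.
From mathcomp Require Import fingroup perm ring.
Set Implicit Arguments.
Unset Strict Implicit.
Unset Printing Implicit Defensive.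
Import Order.TTheory GRing.Theory Num.Theory.
Local Open Scope ring_scope.

(** Write [g = A / N] with [A] integral, so that [A^T J A = N^2 J], and induct
on [n] for integral similitudes [A^T J A = m J].  By the Smith normal form the
content of [A] is a value [x A y] of its bilinear form; after dividing by it,
[x A y = 1], so [y] and [A y] are unimodular and each is the first column of a
matrix of [Sp(Z)].  Moving both to [e1] and clearing the first row leaves
[e1] and [e1^T] fixed, and the similitude relation then forces [J e1] to be
scaled by [m]: a hyperbolic plane splits off.  The result is [diag(d, e)] with
[d_i e_i = m = N^2] and [d_i | e_i], whence [d_i | N]; dividing by [N] yields
[diag(1/q, q)] with [q_i = N / d_i], up to order. *)

(** * Similitudes of the standard symplectic form *)

Lemma sympJ_sqr n (R : comUnitRingType) : sympJ n R *m sympJ n R = - 1%:M.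
Proof.
rewrite mulmx_block !(mul0mx, mulmx0, mul1mx, mulmx1, add0r, addr0).
by rewrite scalar_mx_block opp_block_mx !oppr0.
Qed.

Lemma map_sympJ n (R S : comUnitRingType) (f : {rmorphism R -> S}) :
  map_mx f (sympJ n R) = sympJ n S.
Proof. by rewrite map_block_mx !raddf0 raddfN /= map_mx1. Qed.

(** [m] is not assumed invertible, so the second relation is carried along instead of being derived
    by inverting [A]. *)
Definition simil n (R : comUnitRingType) (m : R) (A : 'M[R]_(n + n)) : Prop :=
  A^T *m sympJ n R *m A = m *: sympJ n R /\
  A *m sympJ n R *m A^T = m *: sympJ n R.

Section Similitudes.

Variables (n : nat) (R : comUnitRingType).
Local Notation J := (sympJ n R).
Implicit Types (A B s : 'M[R]_(n + n)) (a b m : R).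

(** Since [J] squares to [-1], the hypothesis makes [- (J *m A^T *m J)] a left inverse of [A]. *)
Lemma mem_Sp A : A^T *m J *m A = J -> A \in Sp n R.
Proof.
move=> AJA; rewrite inE AJA eqxx andbT.
suff /mulmx1_unit[] : (- (J *m A^T *m J)) *m A = 1%:M by [].
by rewrite mulNmx -!mulmxA (mulmxA A^T) AJA sympJ_sqr opprK.
Qed.

(** A left inverse of a square matrix is also a right inverse; this turns the relation for [s] into
    the one for [s^T]. *)
Lemma SpP s : reflect (simil 1 s) (s \in Sp n R).
Proof.
apply: (iffP idP) => [|[sJs _]]; last by apply: mem_Sp; rewrite sJs scale1r.
rewrite inE => /andP[_ /eqP sJs]; split; rewrite scale1r //.
have /mulmx1C : (- (J *m s^T *m J)) *m s = 1%:M.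
  by rewrite mulNmx -!mulmxA (mulmxA s^T) sJs sympJ_sqr opprK.
rewrite mulmxN => sJsJ; rewrite -[LHS]mulmx1 -[1%:M]opprK -sympJ_sqr mulmxN.
by rewrite -mulNmx -[RHS]mul1mx -sJsJ !mulmxA mulNmx.
Qed.

Lemma simil_mul a b A B : simil a A -> simil b B -> simil (a * b) (A *m B).
Proof.
move=> [A1 A2] [B1 B2]; split; rewrite trmx_mul.
  rewrite (_ : _ *m _ = B^T *m (A^T *m J *m A) *m B); last by rewrite !mulmxA.
  by rewrite A1 -scalemxAr -scalemxAl B1 scalerA.
rewrite (_ : _ *m _ = A *m (B *m J *m B^T) *m A^T); last by rewrite !mulmxA.
by rewrite B2 -scalemxAr -scalemxAl A2 scalerA mulrC.
Qed.

Lemma Sp1 : 1%:M \in Sp n R.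
Proof. by apply: mem_Sp; rewrite trmx1 mul1mx mulmx1. Qed.

Lemma Sp_tr s : s \in Sp n R -> s^T \in Sp n R.
Proof. by move=> /SpP[s1 s2]; apply/SpP; split; rewrite trmxK. Qed.

Lemma Sp_mul s B : s \in Sp n R -> B \in Sp n R -> s *m B \in Sp n R.
Proof.
by move=> /SpP ss /SpP sB; apply/SpP; rewrite -[1]mulr1; apply: simil_mul.
Qed.

Lemma Sp_unit s : s \in Sp n R -> s \in unitmx.
Proof. by rewrite inE => /andP[]. Qed.

Lemma Sp_inv s : s \in Sp n R -> invmx s \in Sp n R.
Proof.
move=> ss; have us := Sp_unit ss; move/SpP: ss => [sJs _].
apply: mem_Sp; rewrite -[in LHS](scale1r J) -sJs trmx_inv -mulmxA.
by rewrite -mulmxA mulmxV // mulmx1 mulmxA mulVmx ?unitmx_tr // mul1mx.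
Qed.

Lemma Sp_opp s : s \in Sp n R -> - s \in Sp n R.
Proof.
move=> /SpP[sJs _]; apply: mem_Sp.
by rewrite [(- s)^T]linearN /= !mulNmx mulmxN opprK sJs scale1r.
Qed.

(** The hypotheses are blocks of the relation preserving [J]; the remaining block is minus the
    transpose of the third one. *)
Lemma Sp_block (a b c d : 'M[R]_n) :
    a^T *m c = c^T *m a -> b^T *m d = d^T *m b -> a^T *m d - c^T *m b = 1%:M ->
  block_mx a b c d \in Sp n R.
Proof.
move=> ac bd ad; apply: mem_Sp.
rewrite tr_block_mx !mulmx_block !(mulmx0, add0r, addr0, mulmx1, mulmxN, mulNmx).
rewrite ac bd !addNr [- _ + _]addrC ad; congr block_mx.
by rewrite -(trmx1 R n) -ad raddfB /= !trmx_mul !trmxK opprB addrC.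
Qed.

End Similitudes.

(** * Orthogonal sums of symplectic spaces *)

Section DirectSum.

Variables (k l : nat) (R : comUnitRingType).
Implicit Types (P Q : 'M[R]_(k + k)) (A B : 'M[R]_(l + l)).

(* The orthogonal sum of two symplectic spaces, in the block order of [sympJ]. *)
Definition sympsum P A : 'M[R]_((k + l) + (k + l)) :=
  block_mx (block_mx (ulsubmx P) 0 0 (ulsubmx A))
           (block_mx (ursubmx P) 0 0 (ursubmx A))
           (block_mx (dlsubmx P) 0 0 (dlsubmx A))
           (block_mx (drsubmx P) 0 0 (drsubmx A)).

Lemma sympsum_mul P Q A B :
  sympsum P A *m sympsum Q B = sympsum (P *m Q) (A *m B).
Proof.
rewrite -[P in RHS]submxK -[Q in RHS]submxK -[A in RHS]submxK -[B in RHS]submxK.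
rewrite !mulmx_block /sympsum !(block_mxKul, block_mxKur, block_mxKdl, block_mxKdr).
by rewrite !(mulmx0, mul0mx, add0r, addr0, add_block_mx).
Qed.

Lemma sympsum_tr P A : (sympsum P A)^T = sympsum P^T A^T.
Proof.
by rewrite /sympsum !tr_block_mx !trmx0 !trmx_ulsub !trmx_ursub
  !trmx_dlsub !trmx_drsub.
Qed.

Lemma sympsumZ m P A : m *: sympsum P A = sympsum (m *: P) (m *: A).
Proof.
rewrite -{2}[P]submxK -{2}[A]submxK /sympsum !scale_block_mx.
by rewrite !(block_mxKul, block_mxKur, block_mxKdl, block_mxKdr) !scaler0.
Qed.

Lemma sympsumJ : sympsum (sympJ k R) (sympJ l R) = sympJ (k + l) R.
Proof.
rewrite /sympsum /sympJ !(block_mxKul, block_mxKur, block_mxKdl, block_mxKdr).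
by rewrite !(@scalar_mx_block _ k l) opp_block_mx !oppr0 !(block_mx0).
Qed.

Lemma sympsum_inj P Q A B : sympsum P A = sympsum Q B -> P = Q /\ A = B.
Proof.
move=> /eq_block_mx[] /eq_block_mx[p1 _ _ a1] /eq_block_mx[p2 _ _ a2].
move=> /eq_block_mx[p3 _ _ a3] /eq_block_mx[p4 _ _ a4].
by rewrite -[P]submxK -[A]submxK p1 p2 p3 p4 a1 a2 a3 a4 !submxK.
Qed.

Lemma simil_sum m P A :
  simil m (sympsum P A) <-> simil m P /\ simil m A.
Proof.
rewrite /simil sympsum_tr -sympsumJ !sympsum_mul sympsumZ; split.
  by move=> [/sympsum_inj[? ?] /sympsum_inj[? ?]].
by move=> [[-> ->] [-> ->]].
Qed.

End DirectSum.

(** * Completing a unimodular vector to a symplectic matrix *)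

(** The pair [(a', b')] can serve as first column of an SL2 matrix, even when [a = b = 0], where
    [(1, 0)] is taken. *)
Lemma bezout_coords (a b : int) :
  exists g a' b' u w : int, [/\ a = a' * g, b = b' * g & a' * u + b' * w = 1].
Proof.
case: (eqVneq (gcdz a b) 0) => [/eqP|g_nz].
  rewrite gcdz_eq0 => /andP[/eqP-> /eqP->].
  by exists 0, 1, 0, 1, 0; rewrite !mulr0 addr0 mulr1.
have /dvdzP[a' Da] := dvdz_gcdl a b; have /dvdzP[b' Db] := dvdz_gcdr a b.
have [u [w Euw]] := Bezoutz a b.
move: (gcdz a b) g_nz Euw Da Db => h h_nz Eh Da Db.
exists h, a', b', u, w; split=> //; apply: (mulIf h_nz).
by rewrite mul1r -[RHS]Eh Da Db; ring.
Qed.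

Definition vec1 (R : pzRingType) n : 'cV[R]_((1 + n) + (1 + n)) :=
  col_mx (col_mx 1%:M 0) 0.
Arguments vec1 : clear implicits.

(** A column has at most one Smith invariant, and the right-hand factor is 1 by 1, so [e] absorbs
    it. *)
Lemma int_col_reduce n (a : 'cV[int]_(1 + n)) :
  exists P e, P \in unitmx /\ a = P *m col_mx e%:M 0.
Proof.
have [L uL [r ur [d _ ->]]] := int_Smith_normal_form a.
exists L, (d`_0 * r 0 0); split=> //.
rewrite -mulmxA; congr (_ *m _).
apply/matrixP=> i j; rewrite !mxE big_ord1 ord1 !mxE.
case: split_ordP => k -> /=; first by rewrite !ord1 !mxE !mulr1n.
by rewrite mxE mulr0n mul0r.
Qed.

(** SL2 matrices in each hyperbolic plane clear the lower half of [v]; GL acting on the upper half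
    then leaves [e] times the first basis vector, and [x] forces [e] to be a unit. *)
Lemma unimodular_completion n (v : 'cV[int]_((1 + n) + (1 + n)))
    (x : 'rV[int]_((1 + n) + (1 + n))) :
  x *m v = 1%:M -> exists2 s, s \in Sp (1 + n) int & s *m vec1 int n = v.
Proof.
move=> xv1.
pose a := usubmx v; pose b := dsubmx v.
have /fin_all_exists[g] := fun i => bezout_coords (a i 0) (b i 0).
move=> /fin_all_exists[a'] /fin_all_exists[b'] /fin_all_exists[u].
move=> /fin_all_exists[w] abuw.
pose D (f : 'I_(1 + n) -> int) := diag_mx (\row_i f i).
have DM f h : D f *m D h = D (fun i => f i * h i).
  by rewrite mulmx_diag; congr diag_mx; apply/rowP=> i; rewrite !mxE.
(* [s1] is in a product of commuting copies of SL2, one per hyperbolic plane. *)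
pose s1 := block_mx (D a') (- D w) (D b') (D u).
have s1S : s1 \in Sp _ int.
  apply: Sp_block; rewrite ?[(- _)^T]linearN /= !tr_diag_mx ?mulNmx ?mulmxN;
    rewrite ?(diag_mxC (\row_i b' i)) ?(diag_mxC (\row_i w i)) // opprK !DM.
  rewrite -raddfD; apply/matrixP=> i j; rewrite !mxE.
  by have [_ _ ->] := abuw i.
have Dv : v = s1 *m col_mx (\col_i g i) 0.
  rewrite -[v]vsubmxK mul_block_col !mulmx0 !addr0.
  by congr col_mx; apply/colP=> i; rewrite mul_diag_mx !mxE; case: (abuw i);
    rewrite !mxE.
have [P [e [uP Dg]]] := int_col_reduce (\col_i g i).
(* GL acts on one Lagrangian and by inverse transpose on the dual one. *)
pose s2 := block_mx P 0 0 (invmx P)^T.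
have s2S : s2 \in Sp _ int.
  apply: Sp_block; rewrite ?(trmx0, mulmx0, mul0mx) // subr0.
  by rewrite -trmx_mul mulVmx // trmx1.
have {Dg}Dv : v = e *: (s1 *m s2 *m vec1 int n).
  rewrite Dv Dg -mulmxA scalemxAr; congr (_ *m _).
  rewrite mul_block_col !mulmx0 mul0mx !addr0 scale_col_mx scaler0 scalemxAr.
  by rewrite scale_col_mx scaler0 scale_scalar_mx mulr1.
have: (e %| 1)%Z.
  apply/dvdzP; exists ((x *m (s1 *m s2 *m vec1 int n)) 0 0).
  have := xv1; rewrite Dv -scalemxAr => /(congr1 (fun A : 'M_1 => A 0 0)).
  by rewrite mxE [in RHS]mxE mulrC => ->.
have s12 := Sp_mul s1S s2S.
(* So [e] is 1 or -1; in the second case the symplectic matrix takes the sign. *)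
rewrite dvdz1 => /eqP; case: e Dv => [e|e] Dv /=.
  by move=> e1; exists (s1 *m s2); rewrite // Dv e1 scale1r.
case=> e0; exists (- (s1 *m s2)); rewrite ?Sp_opp // Dv e0.
by rewrite NegzE scaleN1r mulNmx.
Qed.

(** * Splitting off a hyperbolic plane *)

Lemma row_clearing (R : comUnitRingType) n (x : 'rV[R]_((1 + n) + (1 + n))) :
    x *m vec1 R n = 1%:M ->
  exists s, [/\ s \in Sp (1 + n) R, s *m vec1 R n = vec1 R n
              & x *m s = (vec1 R n)^T].
Proof.
rewrite -[x]hsubmxK -[lsubmx x]hsubmxK -[rsubmx x]hsubmxK.
move: (lsubmx (lsubmx x)) (rsubmx (lsubmx x)) => x0 a.
move: (lsubmx (rsubmx x)) (rsubmx (rsubmx x)) => b c {x}.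
rewrite !mul_row_col !(mulmx0, addr0, mulmx1) => ->.
(* With [x = (1, a | b, c)], [s1] clears [a] and turns [b] into [b']; then [s2] clears [b'] and [c].
   [T] is symmetric because [b'] is 1 by 1. *)
pose P : 'M[R]_(1 + n) := block_mx 1%:M (- a) 0 1%:M.
pose Q : 'M[R]_(1 + n) := block_mx 1%:M 0 a^T 1%:M.
pose b' := b + c *m a^T.
pose T : 'M[R]_(1 + n) := block_mx (- b') (- c) (- c^T) 0.
pose s1 := block_mx P 0 0 Q; pose s2 := block_mx 1%:M T 0 1%:M.
have s1S : s1 \in Sp _ R.
  apply: Sp_block; rewrite ?(trmx0, mulmx0, mul0mx, subr0) //.
  rewrite tr_block_mx mulmx_block !(trmx1, trmx0, mulmx0, mul0mx, addr0, add0r).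
  by rewrite !(mulmx1, mul1mx) [(- a)^T]linearN /= addNr -scalar_mx_block.
have s2S : s2 \in Sp _ R.
  apply: Sp_block;
    rewrite ?(trmx0, trmx1, mulmx0, mul0mx, mul1mx, mulmx1, subr0) //.
  rewrite tr_block_mx trmx0 ![(- _)^T]linearN /= trmxK; congr block_mx.
  by rewrite [b']mx11_scalar tr_scalar_mx.
exists (s1 *m s2); split; first exact: Sp_mul.
  rewrite -mulmxA /vec1 !mul_block_col.
  rewrite !(mulmx0, mul0mx, addr0, add0r, mulmx1, mul1mx).
  by rewrite mul_block_col !(mulmx0, mul0mx, addr0, add0r, mulmx1).
rewrite mulmxA !mul_row_block !(mulmx0, mul0mx, addr0, add0r, mulmx1, mul1mx).
rewrite !tr_col_mx !trmx0 trmx1 addNr -/b' !mul_row_block.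
rewrite !(mulmx0, mul0mx, addr0, add0r, mulmx1, mul1mx) add_row_mx !addNr.
by rewrite row_mx0.
Qed.

(** [e] and [J e] are eigenvectors on both sides, with eigenvalues 1 and [m], so their rows and
    columns vanish off the diagonal. *)
Lemma simil_split (R : comUnitRingType) n m (A : 'M[R]_((1 + n) + (1 + n))) :
    simil m A -> A *m vec1 R n = vec1 R n -> (vec1 R n)^T *m A = (vec1 R n)^T ->
  exists A', A = sympsum (block_mx 1%:M 0 0 m%:M) A'.
Proof.
move=> [sA1 sA2] Ae eA; set e := vec1 R n in Ae eA; set J := sympJ _ _ in sA1 sA2.
(* [J e] is an eigenvector because [A J = m J (A^T)^-1] and [A^T e = e]. *)
have AJe : A *m (J *m e) = m *: (J *m e).
  have Ate : A^T *m e = e by apply: trmx_inj; rewrite trmx_mul trmxK.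
  by rewrite scalemxAl -sA2 -!mulmxA Ate.
have eJA : e^T *m J *m A = m *: (e^T *m J).
  by rewrite scalemxAr -sA1 !mulmxA -[e^T *m A^T]trmx_mul Ae.
move: AJe eJA Ae eA; rewrite {sA1 sA2} /J /sympJ /e /vec1 !tr_col_mx !trmx0 trmx1.
have blocks p q (B : 'M[R]_(p + q)) : exists a b c d, B = block_mx a b c d.
  by exists (ulsubmx B), (ursubmx B), (dlsubmx B), (drsubmx B); rewrite submxK.
have [a [b [c [d ->]]]] := blocks _ _ A.
have [a1 [a2 [a3 [a4 ->]]]] := blocks _ _ a.
have [b1 [b2 [b3 [b4 ->]]]] := blocks _ _ b.
have [c1 [c2 [c3 [c4 ->]]]] := blocks _ _ c.
have [d1 [d2 [d3 [d4 ->]]]] := blocks _ _ d.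
rewrite !(mul_block_col, mul_row_block, mulmx0, mul0mx, addr0, add0r, mulmx1,
  mul1mx, mulmxN, mulNmx).
rewrite !(scale_col_mx, scale_row_mx, scaler0, scalerN, opp_col_mx, opp_row_mx, oppr0,
  add0r, add_col_mx, add_row_mx, mul_block_col, mul_row_block, mulmx0,
  mul0mx, addr0, mulmx1, mul1mx).
rewrite -!(@col_mx0 R 1 n 1) -!(@row_mx0 R 1 1 n).
case/eq_col_mx=> /eq_col_mx[_ /eqP/[!oppr_eq0]/eqP b3E].
case/eq_col_mx=> _ /eqP/[!oppr_eq0]/eqP d3E.
case/eq_row_mx=> /eq_row_mx[c1E c2E] /eq_row_mx[d1E d2E].
case/eq_col_mx=> /eq_col_mx[_ a3E] /eq_col_mx[_ c3E].
case/eq_row_mx=> /eq_row_mx[a1E a2E] /eq_row_mx[b1E b2E].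
exists (block_mx a4 b4 c4 d4).
rewrite /sympsum !(block_mxKul, block_mxKur, block_mxKdl, block_mxKdr).
rewrite a1E a2E a3E b1E b2E b3E c1E c2E c3E d1E d2E d3E ?oppr0.
by rewrite scale_scalar_mx mulr1.
Qed.

(** * Content of an integral similitude *)

(** [d] is the absolute value of the first Smith invariant; up to sign, [x] and [y] extract the
    corner entry 1 of the Smith form divided by it. *)
Lemma int_content m n (A : 'M[int]_(m, n)) : A != 0 ->
  exists d A' x y, [/\ 0 < d, A = d *: A' & x *m A' *m y = 1%:M :> 'M_1].
Proof.
have [L uL [r ur [d dvd_d ->]]] := int_Smith_normal_form A.
set D := \matrix_(i, j) _ => nzD.
case: m n => [|m] [|n] in A L uL r ur D nzD *;
  try by rewrite ?flatmx0 ?thinmx0 eqxx in nzD.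
(* Past the end of the list the default entry is 0, which everything divides. *)
have d0_dvd i : (d`_0 %| d`_i)%Z.
  have [i_lt|/(nth_default 0)->] := ltnP i (size d); last exact: dvdz0.
  have tr_dvd : transitive dvdz by move=> b a c; apply: dvdz_trans.
  apply: (sorted_leq_nth tr_dvd dvdzz 0 dvd_d) => //.
  by rewrite inE (leq_ltn_trans _ i_lt).
have d0_nz : d`_0 != 0.
  apply: contraNneq nzD => d00; rewrite (_ : D = 0) ?mulmx0 ?mul0mx //.
  apply/matrixP=> i j; rewrite !mxE; have := d0_dvd i; rewrite d00 dvd0z => /eqP->.
  by rewrite mul0rn.
pose D' : 'M[int]_(m.+1, n.+1) :=
  \matrix_(i, j) ((d`_i %/ d`_0)%Z *+ (i == j :> nat)).
have DD' : D = d`_0 *: D'.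
  by apply/matrixP=> i j; rewrite !mxE mulrnAr [_ * (_ %/ _)%Z]mulrC divzK.
(* The sign of the first invariant goes both into the matrix and into [x], so that it cancels in the
   product. *)
exists `|d`_0|, (sgz d`_0 *: (L *m D' *m r)).
exists (sgz d`_0 *: row 0 (invmx L)), (col 0 (invmx r)).
split; first by rewrite normr_gt0.
  rewrite DD' scalerA -scalemxAr -scalemxAl; congr (_ *: _).
  by rewrite mulrC; exact: intEsg.
rewrite -!(scalemxAl, scalemxAr) scalerA mulz_sg d0_nz scale1r.
rewrite -row_mul !mulmxA mulVmx // mul1mx row_mul colE -mulmxA.
rewrite (mulmxA r) mulmxV // mul1mx -colE; apply/matrixP=> i j.
by rewrite !ord1 !mxE divzz d0_nz.
Qed.

(** The multiplier [m'] is read off at an entry where [sympJ] is 1; then [d ^+ 2] cancels. *)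
Lemma simil_content n m d (A : 'M[int]_(n.+1 + n.+1)) :
  d != 0 -> simil m (d *: A) -> exists2 m', m = d ^+ 2 * m' & simil m' A.
Proof.
move=> nz_d; rewrite /simil [(d *: A)^T]linearZ /=.
rewrite -!(scalemxAl, scalemxAr) !scalerA -expr2 => -[A1 A2].
pose m' := (A^T *m sympJ _ _ *m A) (lshift _ ord0) (rshift _ ord0).
have Dm : m = d ^+ 2 * m'.
  have /matrixP/(_ (lshift _ ord0) (rshift _ ord0)) := A1.
  by rewrite mxE [in RHS]mxE block_mxEur [1%:M _ _]mxE eqxx mulr1 => <-.
have cancel (X Y : 'M[int]_(n.+1 + n.+1)) : d ^+ 2 *: X = d ^+ 2 *: Y -> X = Y.
  move=> /matrixP XY; apply/matrixP=> i j; apply: (mulfI (expf_neq0 2 nz_d)).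
  by have := XY i j; rewrite mxE [in RHS]mxE.
by exists m' => //; rewrite Dm -(scalerA (d ^+ 2)) in A1 A2; split; apply: cancel.
Qed.

(** * Normal form of integral similitudes *)

Lemma Sp_sum n (R : comUnitRingType) (s : 'M[R]_(n + n)) :
  s \in Sp n R -> sympsum (1%:M : 'M_(1 + 1)) s \in Sp (1 + n) R.
Proof.
by move=> /SpP ss; apply/SpP/simil_sum; split=> //; apply/SpP/Sp1.
Qed.

Lemma simil_clear n m (A : 'M[int]_((1 + n) + (1 + n))) x y :
    simil m A -> x *m A *m y = 1%:M :> 'M_1 ->
  exists s s' A', [/\ s \in Sp _ int, s' \in Sp _ int, simil m A'
    & A = s *m sympsum (block_mx 1%:M 0 0 m%:M) A' *m s'].
Proof.
move=> sA xAy.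
have [s sS De] := unimodular_completion xAy.
have [t tS Dt] : exists2 t, t \in Sp _ int & t *m vec1 int n = A *m y.
  by apply: (@unimodular_completion _ _ x); rewrite mulmxA.
have us := Sp_unit sS; have ut := Sp_unit tS.
pose B := invmx t *m A *m s.
have Be : B *m vec1 int n = vec1 int n.
  by rewrite -!mulmxA De -Dt mulKmx.
(* As [B] fixes the first basis vector, its first row starts with 1 and can be cleared; [r] keeps
   the first column. *)
have [r [rS re eBr]] : exists r, [/\ r \in Sp _ int,
    r *m vec1 int n = vec1 int n & (vec1 int n)^T *m B *m r = (vec1 int n)^T].
  apply: row_clearing; rewrite -mulmxA Be /vec1 !tr_col_mx !mul_row_col.
  by rewrite !trmx0 trmx1 !mulmx0 !addr0 mulmx1.
have ur := Sp_unit rS.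
have sBr : simil m (B *m r).
  rewrite -[m]mulr1; apply: simil_mul; last exact/SpP.
  rewrite -[m]mulr1; apply: simil_mul; last exact/SpP.
  by rewrite -[m]mul1r; apply: simil_mul => //; apply/SpP/Sp_inv.
have [A' DA'] : exists A', B *m r = sympsum (block_mx 1%:M 0 0 m%:M) A'.
  apply: (simil_split sBr); last by rewrite mulmxA.
  by rewrite -mulmxA re.
exists t, (invmx r *m invmx s), A'; split=> //.
- by rewrite Sp_mul ?Sp_inv.
- by move: sBr; rewrite DA' => /simil_sum[].
by rewrite -DA' !mulmxA mulmxK // mulmxV // mul1mx mulmxK.
Qed.

Lemma simil_Smith n (m : int) (A : 'M[int]_(n + n)) : 0 < m -> simil m A ->
  exists s s' d e, [/\ s \in Sp n int, s' \in Sp n int,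
    A = s *m block_mx (diag_mx d) 0 0 (diag_mx e) *m s',
    forall i, [/\ 0 < d ord0 i, d ord0 i * e ord0 i = m & (d ord0 i %| e ord0 i)%Z]
  & forall i j : 'I_n, (i <= j)%N -> (d ord0 i %| d ord0 j)%Z].
Proof.
elim: n m A => [|n IHn] m A m_gt0 sA.
  exists 1%:M, 1%:M, 0, 0; split; rewrite ?Sp1 //; try by case.
  by apply/matrixP=> -[].
have nzA : A != 0.
  apply: contraTneq m_gt0 => A0; move: sA => [+ _].
  rewrite A0 mulmx0 => /matrixP/(_ (lshift _ ord0) (rshift _ ord0)).
  by rewrite mxE [in RHS]mxE block_mxEur [1%:M _ _]mxE eqxx mulr1 => <-.
have [c [B [x [y [c_gt0 DA xBy]]]]] := int_content nzA.
have nz_c : c != 0 by rewrite gt_eqF.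
rewrite {}DA in sA *; have [m' Dm sB] := simil_content nz_c sA.
have m'_gt0 : 0 < m' by rewrite Dm pmulr_rgt0 // exprn_gt0 in m_gt0.
have [s [s' [C [sS s'S sC ->]]]] := @simil_clear n m' B x y sB xBy.
have [t [t' [d [e [tS t'S -> de dd]]]]] := IHn m' C m'_gt0 sC.
exists (s *m sympsum (1%:M : 'M_(1 + 1)) t), (sympsum (1%:M : 'M_(1 + 1)) t' *m s').
(* The split block [diag(1, m')] is rescaled by the content [c], which divides all later entries;
   [c * (c * m') = m]. *)
exists (row_mx c%:M (c *: d)), (row_mx (c * m')%:M (c *: e)).
split; try by rewrite Sp_mul // Sp_sum.
- set D := block_mx (diag_mx d) 0 0 _; set P := block_mx 1%:M 0 0 _.
  have -> : sympsum P (t *m D *m t') =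
      sympsum (1%:M : 'M_(1 + 1)) t *m sympsum P D
        *m sympsum (1%:M : 'M_(1 + 1)) t'.
    by rewrite !sympsum_mul mul1mx mulmx1.
  rewrite (_ : block_mx (diag_mx _) _ _ _ = c *: sympsum P D).
    by rewrite -!scalemxAr -!scalemxAl !mulmxA.
  rewrite /sympsum !(block_mxKul, block_mxKur, block_mxKdl, block_mxKdr).
  have diagE f (v : 'rV[int]_n) :
      diag_mx (row_mx f%:M (c *: v) : 'rV_(1 + n))
        = block_mx f%:M 0 0 (c *: diag_mx v).
    rewrite diag_mx_row linearZ; congr (block_mx _ _ _ _).
    by apply/matrixP=> i j; rewrite !ord1 !mxE.
  by rewrite !diagE !scale_block_mx !scaler0 !block_mx0 !scale_scalar_mx mulr1.
- move=> i; rewrite !mxE; case: split_ordP => k _; rewrite !mxE.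
    rewrite (ord1 k) !mulr1n dvdz_mulr // c_gt0; split=> //.
    by rewrite Dm mulrA.
  have [d_gt0 dem d_e] := de k; split; first by rewrite mulr_gt0.
    by rewrite mulrACA dem -expr2.
  by rewrite dvdz_mul.
move=> i j; rewrite !mxE.
case: split_ordP => k ->; case: split_ordP => l -> le_kl;
  rewrite !mxE ?(ord1 k) ?(ord1 l) ?mulr1n.
- by [].
- by move: le_kl; rewrite /= (ord1 k).
- by rewrite dvdz_mulr.
by rewrite dvdz_mul // dd // -(leq_add2l 1).
Qed.

(** * Back to rational symplectic matrices *)

Lemma common_denominator m n (g : 'M[rat]_(m, n)) :
  exists2 N : int, 0 < N & exists A, N%:~R *: g = map_mx intr A.
Proof.
pose N := \prod_i \prod_j denq (g i j).
have N_gt0 : 0 < N by apply: prodr_gt0 => i _; apply: prodr_gt0 => j _.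
exists N => //; exists (\matrix_(i, j) (numq (g i j) * (N %/ denq (g i j))%Z)).
apply/matrixP=> i j; rewrite !mxE rmorphM /=.
have dvdN : (denq (g i j) %| N)%Z.
  by rewrite /N (bigD1 i) //= (bigD1 j) //= -mulrA dvdz_mulr.
rewrite -{1}(divzK dvdN) rmorphM /= numqE; ring.
Qed.

Lemma simil_of_map n (R S : comUnitRingType) (f : {rmorphism R -> S}) m
    (A : 'M[R]_(n + n)) :
  injective f -> simil (f m) (map_mx f A) -> simil m A.
Proof.
move=> inj_f; rewrite /simil map_trmx -(map_sympJ n f) -!map_mxM -map_mxZ.
have cancel (X Y : 'M[R]_(n + n)) : map_mx f X = map_mx f Y -> X = Y.
  move=> /matrixP XY; apply/matrixP=> i j; apply: inj_f.
  by have := XY i j; rewrite !mxE.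
by move=> [A1 A2]; split; apply: cancel.
Qed.

(* Exchanges the two Lagrangians and reverses their bases: this turns
[diag(1/q, q)] with decreasing divisibility into the required normal form. *)
Definition swap_rev n (R : comUnitRingType) : 'M[R]_(n + n) :=
  block_mx 0 (perm_mx (perm rev_ord_inj)) (- perm_mx (perm rev_ord_inj)) 0.

Lemma swap_rev_Sp n (R : comUnitRingType) : swap_rev n R \in Sp n R.
Proof.
apply: Sp_block; rewrite ?(trmx0, mulmx0, mul0mx) // sub0r.
by rewrite [(- _)^T]linearN /= mulNmx opprK tr_perm_mx -perm_mxM mulVg perm_mx1.
Qed.

Lemma swap_rev_tr n (R : comUnitRingType) (d e : 'rV[R]_n) :
  swap_rev n R *m block_mx (diag_mx d) 0 0 (diag_mx e) *m (swap_rev n R)^T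
    = block_mx (diag_mx (\row_i e 0 (rev_ord i))) 0
             0 (diag_mx (\row_i d 0 (rev_ord i))).
Proof.
rewrite /swap_rev tr_block_mx !mulmx_block !(trmx0, mulmx0, mul0mx, addr0, add0r).
rewrite [(- _)^T]linearN /= mulmxN !mulNmx opprK tr_perm_mx -!row_permE -!col_permE.
by congr block_mx; apply/matrixP=> i j; rewrite !mxE !permE (inj_eq rev_ord_inj).
Qed.

Theorem theorem2p1 (n : nat) (hn : (1 <= n)%N) (g : 'M[rat]_(n + n))
    (hg : g \in Sp n rat) :
  exists (s s' : 'M[int]_(n + n)) (d : 'rV[int]_n),
    [/\ s \in Sp n int,
        s' \in Sp n int,
        forall i : 'I_n, 0 < d ord0 i,
        forall i j : 'I_n, (j = i.+1 :> nat) -> (d ord0 i %| d ord0 j)%Z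
      & let D : 'M[rat]_n := map_mx intr (diag_mx d) in
        g = map_mx intr s *m block_mx D 0 0 (invmx D) *m map_mx intr s'].
Proof.
have [N N_gt0 [A DA]] := common_denominator g.
have nzN : N%:~R != 0 :> rat by rewrite intr_eq0 gt_eqF.
have sA : simil (N ^+ 2) A.
  apply: (@simil_of_map _ _ _ (intr : int -> rat)); first exact: intr_inj.
  rewrite -DA rmorphXn /=; case/SpP: hg => g1 g2; split.
    rewrite [(_ *: g)^T]linearZ /= -!(scalemxAl, scalemxAr) scalerA -expr2.
    by rewrite g1 scale1r.
  rewrite [(_ *: g)^T]linearZ /= -!(scalemxAl, scalemxAr) scalerA -expr2.
  by rewrite g2 scale1r.
have [s [s' [d [e [sS s'S Ds de dd]]]]] := simil_Smith (exprn_gt0 2 N_gt0) sA.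
pose q i := (N %/ d ord0 i)%Z.
have dq i : q i * d ord0 i = N.
  have [d_gt0 dem d_e] := de i; apply: divzK.
  (* [d_i] divides [e_i], so [d_i^2] divides [d_i e_i = N^2], and squares reflect divisibility. *)
  suff: (d ord0 i ^+ 2 %| N ^+ 2)%Z by rewrite !dvdzE !abszX dvdn_pexp2r.
  by rewrite -dem expr2 dvdz_mul.
have q_gt0 i : 0 < q i.
  by have [d_gt0 _ _] := de i; rewrite -(pmulr_lgt0 _ d_gt0) dq.
(* Hence dividing by [N] turns [d_i] into [1 / q_i] and [e_i] into [q_i]. *)
have eE i : e ord0 i = q i * N.
  have [d_gt0 dem _] := de i; apply: (mulfI (lt0r_neq0 d_gt0)).
  by rewrite dem mulrA [_ * q i]mulrC dq.
have qdvd (i j : 'I_n) : (i <= j)%N -> (q j %| q i)%Z.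
  move=> /dd /dvdzP[c dj]; have [d_gt0 _ _] := de i.
  apply/dvdzP; exists c; apply: (mulIf (lt0r_neq0 d_gt0)).
  by rewrite dq -(dq j) dj mulrCA mulrA.
pose w := swap_rev n int.
have wS : w \in Sp n int := swap_rev_Sp n int.
(* Divisibility of the [q_i] runs backwards and [q] sits in the second block; [w] corrects both. *)
exists (s *m w), (w^T *m s'), (\row_i q (rev_ord i)).
split; try by rewrite Sp_mul ?Sp_tr.
- by move=> i; rewrite mxE.
- by move=> i j ij; rewrite !mxE qdvd //= leq_sub2l // ij.
move=> D.
have DE : D = diag_mx (\row_i (q (rev_ord i))%:~R).
  by rewrite /D map_diag_mx; congr diag_mx; apply/rowP=> i; rewrite !mxE.
have DV : invmx D = diag_mx (\row_i (q (rev_ord i))%:~R^-1).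
  set V := diag_mx _.
  have VD : V *m D = 1%:M.
    rewrite DE mulmx_diag -diag_const_mx; congr diag_mx; apply/rowP=> i.
    by rewrite !mxE mulVf // intr_eq0 gt_eqF.
  have [_ uD] := mulmx1_unit VD.
  by rewrite -[V]mulmx1 -(mulmxV uD) mulmxA VD mul1mx.
have wE : map_mx intr w = swap_rev n rat.
  by rewrite map_block_mx !raddf0 raddfN /= !map_perm_mx.
have deE : map_mx intr (block_mx (diag_mx d) 0 0 (diag_mx e)) =
    N%:~R *: (swap_rev n rat *m block_mx D 0 0 (invmx D) *m (swap_rev n rat)^T).
  rewrite DV DE swap_rev_tr scale_block_mx !scaler0 map_block_mx !raddf0 /=.
  rewrite !map_diag_mx -!linearZ /=; congr block_mx; congr diag_mx; apply/rowP=> i.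
    rewrite !mxE rev_ordK -(dq i) rmorphM /= mulrAC divff ?mul1r //.
    by rewrite intr_eq0 gt_eqF.
  by rewrite !mxE rev_ordK eE rmorphM mulrC.
apply: (scalerI nzN); rewrite DA Ds !map_mxM -map_trmx wE deE.
by rewrite -scalemxAr -scalemxAl !mulmxA.
Qed.
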